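(* Let $n\ge1$, $V=\mathbb{C}^n$, and let $T=T(V)\otimes T(V^* )$ be the mixed tensor algebra over $V$. For any $*$-subgroup $G$ of $\mathrm{GL}(n,\mathbb{C})$, $$\mathrm{GL}(n,\mathbb{C})^{T^G}=\overline{G},$$ where $\overline G$ is the Zariski closure of $G$ in $\mathrm{GL}(n,\mathbb{C})$.
   Context: $T(V)=\bigoplus_{k\ge 0}V^{\otimes k}$, $T(V^* )=\bigoplus_{k\ge 0}V^{*\otimes k}$, and $T=T(V)\otimes T(V^* )\cong\bigoplus_{k,l\ge 0}V^{\otimes k}\otimes V^{*\otimes l}$, with multiplication (also written $\otimes$) $(x\otimes y)\otimes(x'\otimes y')=(x\otimes x')\otimes(y\otimes y')$ for $x,x'\in T(V)$, $y,y'\in T(V^* )$. For $U\in \mathrm{GL}(n,\mathbb{C})$, $z\mapsto z^U$ is the unique algebra endomorphism of $T$ with $x^U=Ux$ for $x\in V$ and $y^U=(U^{\mathsf T})^{-1}y$ for $y\in V^*$ (coordinates with respect to the dual basis; i.e. $y^U=y\circ U^{-1}$). For $G\subseteq \mathrm{GL}(n,\mathbb{C})$, $T^G:=\{z\in T\mid z^U=z \text{ for all } U\in G\}$. For $A\subseteq T$, $\mathrm{GL}(n,\mathbb{C})^A:=\{U\in \mathrm{GL}(n,\mathbb{C})\mid z^U=z\text{ for all }z\in A\}$. A subgroup $G$ of $\mathrm{GL}(n,\mathbb{C})$ is a $*$-subgroup if $G=G^*:=\{U^*\mid U\in G\}$ ($U^*$ the conjugate transpose). Zariski closure: with $\mathcal{I}_G:=\{p\in\mathbb{C}[x_{1,1},x_{1,2},\ldots,x_{n,n}]\mid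 p(U)=0\text{ for each }U\in G\}$, one sets $\overline G=\{U\in\mathrm{GL}(n,\mathbb{C})\mid p(U)=0\text{ for each }p\in\mathcal{I}_G\}$. *)

(* Defs.v *)
From HB Require Import structures.
From mathcomp Require Import all_boot all_order all_algebra.
From mathcomp Require Import boolp classical_sets reals.
From mathcomp Require Import finmap complex.
From mathcomp.multinomials Require Import monalg.
From mathcomp.multinomials Require mpoly.

Set Implicit Arguments.
Unset Strict Implicit.
Unset Printing Implicit Defensive.

Import Order.TTheory GRing.Theory Num.Theory.
Local Open Scope ring_scope.

(** * Mixed tensor algebra

    V = F^n is 'cV[F]_n with its standard basis e_0, ..., e_(n-1), and V^* is
    also 'cV[F]_n, through coordinates with respect to the dual basis.

    The tensors e_(i_1) (x) ... (x) e_(i_k), indexed by words in 'I_n, form a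
    basis of T(V), and they are multiplied by concatenation: T(V) is the algebra
    of the free monoid {fmonom 'I_n}.  Pairs of words index in the same way a
    basis of T(V) (x) T(V^* ); by the rule
      (x (x) y) (x' (x) y') = (x x') (x) (y y')    (lemma tensM)
    basis elements are multiplied by concatenating both components, so that
    T(V) (x) T(V^* ) is the algebra of the product monoid. *)

Section ProdMonom.
Variables M N : monomType.

Definition prod_mone : M * N := (@mone M, @mone N).
Definition prod_mmul (x y : M * N) : M * N := (mmul x.1 y.1, mmul x.2 y.2).

Fact prod_mmulA : associative prod_mmul.
Proof. by move=> x y z; rewrite /prod_mmul !mulmA. Qed.
Fact prod_mmul1m : left_id prod_mone prod_mmul.
Proof. by case=> x y; rewrite /prod_mmul /= !mul1m. Qed.
Fact prod_mmulm1 : right_id prod_mone prod_mmul.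
Proof. by case=> x y; rewrite /prod_mmul /= !mulm1. Qed.
Fact prod_unitm x y : prod_mmul x y = prod_mone -> x = prod_mone /\ y = prod_mone.
Proof. by case: x y => [a b] [c d] [/unitm[-> ->] /unitm[-> ->]]. Qed.

HB.instance Definition _ := Choice_isMonomialDef.Build (M * N)%type
  prod_mmulA prod_mmul1m prod_mmulm1 prod_unitm.
End ProdMonom.

Notation tensor_algebra F n := {malg F[{fmonom 'I_n}]}.
Notation mixed_algebra F n :=
  {malg F[({fmonom 'I_n} * {fmonom 'I_n})%type]}.

(* x (x) y for x in T(V) and y in T(V^* ); locked to keep unification from
   unfolding it. *)
HB.lock Definition tens (F : fieldType) (n : nat) (x y : tensor_algebra F n) :
    mixed_algebra F n :=
  \sum_(k <- msupp x) \sum_(l <- msupp y) << x@_k * y@_l *g (k, l) >>.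

Section MixedTensors.
Variables (F : fieldType) (n : nat).
Implicit Types (x y : tensor_algebra F n) (z : mixed_algebra F n).
Implicit Types (u v : 'cV[F]_n) (U : 'M[F]_n).

(* The inclusion in degree 1 of V in T(V), or of V^* in T(V^* ). *)
Definition tensor1 u : tensor_algebra F n := \sum_(i < n) << u i 0 *g fmu i >>.

Definition vec u : mixed_algebra F n := tens (tensor1 u) 1.
Definition covec u : mixed_algebra F n := tens 1 (tensor1 u).

(* The image under U of the basis element of T indexed by k. *)
Definition word_act U (k : {fmonom 'I_n} * {fmonom 'I_n}) : mixed_algebra F n :=
  (\prod_(i <- (k.1 : seq 'I_n)) vec (U *m delta_mx i 0)) *
  (\prod_(j <- (k.2 : seq 'I_n)) covec (invmx U^T *m delta_mx j 0)).

(* z^U, for U invertible.  It is an algebra endomorphism of T (see the instances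
   below), the only one with x^U = U x on V and y^U = (U^T)^-1 y on V^*: lemmas
   mact_vec, mact_covec and mact_uniq. *)
Definition mact U z : mixed_algebra F n :=
  \sum_(k <- msupp z) z@_k *: word_act U k.

Lemma mcoeff_tens x y k l : (tens x y)@_(k, l) = x@_k * y@_l.
Proof.
rewrite tens.unlock [in RHS](monalgE x) [in RHS](monalgE y) !raddf_sum /= mulr_suml.
apply: eq_bigr => k' _; rewrite raddf_sum mulr_sumr; apply: eq_bigr => l' _ /=.
rewrite !mcoeffU xpair_eqE.
by case: (k' == k); case: (l' == l); rewrite ?(mulr0n, mulr1n, mulr0, mul0r).
Qed.

Lemma tensDl x x' y : tens (x + x') y = tens x y + tens x' y.
Proof. by apply/malgP => -[k l]; rewrite mcoeffD 3!mcoeff_tens mcoeffD mulrDl. Qed.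

Lemma tensDr x y y' : tens x (y + y') = tens x y + tens x y'.
Proof. by apply/malgP => -[k l]; rewrite mcoeffD 3!mcoeff_tens mcoeffD mulrDr. Qed.

Lemma tensZl a x y : tens (a *: x) y = a *: tens x y.
Proof. by apply/malgP => -[k l]; rewrite mcoeffZ 2!mcoeff_tens mcoeffZ mulrA. Qed.

Lemma tensZr a x y : tens x (a *: y) = a *: tens x y.
Proof. by apply/malgP => -[k l]; rewrite mcoeffZ 2!mcoeff_tens mcoeffZ mulrCA. Qed.

Lemma tens0l y : tens 0 y = 0.
Proof. by rewrite -[0 in LHS](scale0r 0) tensZl scale0r. Qed.

Lemma tens0r x : tens x 0 = 0.
Proof. by rewrite -[0 in LHS](scale0r 0) tensZr scale0r. Qed.

Lemma tensUU a b (k l : {fmonom 'I_n}) :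
  @tens F n << a *g k >> << b *g l >> = << a * b *g (k, l) >>.
Proof.
apply/malgP => -[k' l']; rewrite mcoeff_tens !mcoeffU xpair_eqE.
by case: (k == k'); case: (l == l'); rewrite ?(mulr0n, mulr1n, mulr0, mul0r).
Qed.

Lemma commr_mulACA (R : nzRingType) (a b c d : R) :
  GRing.comm b c -> (a * b) * (c * d) = (a * c) * (b * d).
Proof. by move=> bc; rewrite -[LHS]mulrA (mulrA b) bc !mulrA. Qed.

Lemma malgUM (K : monomType) (a b : F) (k l : K) :
  << a *g k >> * << b *g l >> = << a * b *g mmul k l >> :> {malg F[K]}.
Proof. exact: fgmulUU. Qed.

Lemma malgUZ (K : choiceType) (a : F) (k : K) :
  << a *g k >> = a *: << k >> :> {malg F[K]}.
Proof.
by apply/malgP => k'; rewrite mcoeffZ !mcoeffU; case: (k == k'); rewrite /= ?mulr1 ?mulr0.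
Qed.

Lemma tens11 : @tens F n 1 1 = 1.
Proof. by rewrite tensUU mulr1. Qed.

Lemma tens_suml (I : Type) (r : seq I) (f : I -> tensor_algebra F n) y :
  tens (\sum_(i <- r) f i) y = \sum_(i <- r) tens (f i) y.
Proof.
by elim: r => [|i r IHr]; rewrite ?big_nil ?tens0l // !big_cons tensDl IHr.
Qed.

Lemma tens_sumr (I : Type) (r : seq I) (f : I -> tensor_algebra F n) x :
  tens x (\sum_(i <- r) f i) = \sum_(i <- r) tens x (f i).
Proof.
by elim: r => [|i r IHr]; rewrite ?big_nil ?tens0r // !big_cons tensDr IHr.
Qed.

Lemma tensM x x' y y' : tens x y * tens x' y' = tens (x * x') (y * y').
Proof.
have ind (P : tensor_algebra F n -> Prop) :
    (forall a k, P << a *g k >>) -> P 0 -> (forall a b, P a -> P b -> P (a + b)) ->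
  forall t, P t.
  by move=> PU P0 PD t; rewrite (monalgE t); apply: big_ind.
elim/ind: x => [a k||s t IHs IHt]; first last.
- by rewrite tensDl !mulrDl IHs IHt tensDl.
- by rewrite mul0r !tens0l mul0r.
elim/ind: x' => [a' k'||s t IHs IHt]; first last.
- by rewrite tensDl !mulrDr IHs IHt tensDl.
- by rewrite mulr0 !tens0l mulr0.
elim/ind: y => [b l||s t IHs IHt]; first last.
- by rewrite tensDr !mulrDl IHs IHt tensDr.
- by rewrite mul0r !tens0r mul0r.
elim/ind: y' => [b' l'||s t IHs IHt]; first last.
- by rewrite tensDr !mulrDr IHs IHt tensDr.
- by rewrite mulr0 !tens0r mulr0.
by rewrite !tensUU !malgUM !tensUU mulrACA.
Qed.

Lemma mcoeff_tensor1 u i : (tensor1 u)@_(fmu i) = u i 0.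
Proof.
rewrite raddf_sum (bigD1 i) //= mcoeffUU big1 ?addr0 // => j /negPf ji.
rewrite mcoeffU (_ : (fmu j == fmu i) = false) //.
by rewrite fmP !fmU /= eqseq_cons eqxx andbT ji.
Qed.

Lemma tensor1_is_linear : linear tensor1.
Proof.
move=> a u v; rewrite /tensor1 scaler_sumr -big_split /=; apply: eq_bigr => i _.
rewrite !mxE monalgUD; congr (_ + _).
by rewrite malgUZ [in RHS]malgUZ scalerA.
Qed.

HB.instance Definition _ :=
  GRing.isLinear.Build F 'cV[F]_n (tensor_algebra F n) *:%R tensor1
    tensor1_is_linear.

Lemma vec_is_linear : linear vec.
Proof. by move=> a u v; rewrite /vec linearP tensDl tensZl. Qed.

Lemma covec_is_linear : linear covec.
Proof. by move=> a u v; rewrite /covec linearP tensDr tensZr. Qed.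

HB.instance Definition _ :=
  GRing.isLinear.Build F 'cV[F]_n (mixed_algebra F n) *:%R vec vec_is_linear.
HB.instance Definition _ :=
  GRing.isLinear.Build F 'cV[F]_n (mixed_algebra F n) *:%R covec covec_is_linear.

Lemma vec_covecC u v : GRing.comm (vec u) (covec v).
Proof. by rewrite /GRing.comm !tensM !mul1r !mulr1. Qed.

Lemma tensor1_delta i : tensor1 (delta_mx i 0) = << fmu i >>.
Proof.
rewrite /tensor1 (bigD1 i) //= !mxE !eqxx /= big1 ?addr0 // => j /negPf ji.
by rewrite mxE ji /= raddf0.
Qed.

Lemma vec_delta i : vec (delta_mx i 0) = << (fmu i, mone) >>.
Proof. by rewrite /vec tensor1_delta tensUU mulr1. Qed.

Lemma covec_delta i : covec (delta_mx i 0) = << (mone, fmu i) >>.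
Proof. by rewrite /covec tensor1_delta tensUU mulr1. Qed.

Lemma malg_wordE (k : {fmonom 'I_n} * {fmonom 'I_n}) :
  << k >> = (\prod_(i <- (k.1 : seq 'I_n)) vec (delta_mx i 0)) *
            (\prod_(j <- (k.2 : seq 'I_n)) covec (delta_mx j 0))
  :> mixed_algebra F n.
Proof.
have wordl (w : seq 'I_n) : \prod_(i <- w) vec (delta_mx i 0) =
    << (FMonom w, mone) >> :> mixed_algebra F n.
  elim: w => [|i w IHw]; first by rewrite big_nil -fmoneE.
  rewrite big_cons IHw vec_delta malgUM mulr1; congr << _ >>.
  rewrite /mmul /= /prod_mmul /=; congr (_, _); last exact: mul1m.
  by apply: val_inj; rewrite /= fmM fmU.
have wordr (w : seq 'I_n) : \prod_(i <- w) covec (delta_mx i 0) =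
    << (mone, FMonom w) >> :> mixed_algebra F n.
  elim: w => [|i w IHw]; first by rewrite big_nil -fmoneE.
  rewrite big_cons IHw covec_delta malgUM mulr1; congr << _ >>.
  rewrite /mmul /= /prod_mmul /=; congr (_, _); first exact: mul1m.
  by apply: val_inj; rewrite /= fmM fmU.
case: k => k l; rewrite wordl wordr malgUM mulr1 /=; congr << _ >>.
by rewrite /mmul /= /prod_mmul /= mul1m mulm1 !fmK.
Qed.

Lemma word_act_mmorphism U : mmorphism (word_act U).
Proof.
split=> [[k1 k2] [l1 l2]|]; last first.
  rewrite /word_act; have -> : (@mone ({fmonom 'I_n} * {fmonom 'I_n})%type).1 =
    [::] :> seq 'I_n by exact: fm1.
  by rewrite !big_nil mulr1.
rewrite /word_act.
have -> : (mmul (k1, k2) (l1, l2)).1 = k1 ++ l1 :> seq 'I_n by exact: fmM.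
have -> : (mmul (k1, k2) (l1, l2)).2 = k2 ++ l2 :> seq 'I_n by exact: fmM.
rewrite !big_cat; apply: commr_mulACA.
apply: commr_prod => j _; apply/commr_sym; apply: commr_prod => i _.
exact/commr_sym/vec_covecC.
Qed.

HB.instance Definition _ U :=
  isMultiplicative.Build _ (mixed_algebra F n) (word_act U)
    (word_act_mmorphism U).

Lemma mactE U z : mact U z = mmap (@malgC _ F) (word_act U) z.
Proof. by apply: eq_bigr => k _; rewrite -mul_malgC. Qed.

Lemma mact_is_linear U : linear (mact U).
Proof.
move=> a z z'; rewrite !mactE raddfD /= mmapZ; congr (_ + _).
by rewrite -mul_malgC.
Qed.

Lemma mulr_malgC (K : monomType) (a : F) (z : {malg F[K]}) :
  z * a%:MP = a *: z.
Proof.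
by rewrite malgM_def malgZ_def fgmulgU; apply: eq_bigr => k _; rewrite mulm1 mulrC.
Qed.

Lemma mact_is_monoid_morphism U : monoid_morphism (mact U).
Proof.
have comm_act (g : mixed_algebra F n) k l :
    GRing.comm (g@_k)%:MP (word_act U l).
  by rewrite /GRing.comm mul_malgC mulr_malgC.
have := commr_mmap_is_multiplicative comm_act.
case=> mM m1; split=> [|z z']; first by rewrite mactE m1.
by rewrite !mactE mM.
Qed.

HB.instance Definition _ U :=
  GRing.isLinear.Build F (mixed_algebra F n) (mixed_algebra F n) *:%R (mact U)
    (mact_is_linear U).
HB.instance Definition _ U :=
  GRing.isMonoidMorphism.Build (mixed_algebra F n) (mixed_algebra F n) (mact U)
    (mact_is_monoid_morphism U).

Lemma mact_word U k : mact U << k >> = word_act U k.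
Proof. by rewrite mactE mmapU mul_malgC scale1r. Qed.

Lemma cV_sum_delta u : u = \sum_i u i 0 *: delta_mx i 0.
Proof. by rewrite [LHS]matrix_sum_delta; apply: eq_bigr => i _; rewrite big_ord1. Qed.

Lemma mact_vec U u : mact U (vec u) = vec (U *m u).
Proof.
rewrite [u]cV_sum_delta mulmx_sumr !linear_sum; apply: eq_bigr => i _.
rewrite -scalemxAr !linearZ /= vec_delta mact_word /word_act /=.
by rewrite fmU fm1 big_seq1 big_nil mulr1.
Qed.

Lemma mact_covec U u : mact U (covec u) = covec (invmx U^T *m u).
Proof.
rewrite [u]cV_sum_delta mulmx_sumr !linear_sum; apply: eq_bigr => i _.
rewrite -scalemxAr !linearZ /= covec_delta mact_word /word_act /=.
by rewrite fmU fm1 big_seq1 big_nil mul1r.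
Qed.

Lemma mact_uniq U (f : {lrmorphism mixed_algebra F n -> mixed_algebra F n}) :
  (forall u, f (vec u) = vec (U *m u)) ->
  (forall u, f (covec u) = covec (invmx U^T *m u)) ->
  f =1 mact U.
Proof.
move=> fV fVd z; rewrite /mact [in LHS](monalgE z) linear_sum.
apply: eq_bigr => k _; rewrite malgUZ linearZ /= malg_wordE rmorphM /=.
rewrite !rmorph_prod; congr (_ *: (_ * _)).
  by apply: eq_bigr => i _; exact: fV.
by apply: eq_bigr => j _; exact: fVd.
Qed.
End MixedTensors.

(** * Invariants, stabilizers and Zariski closure

    GL(n, F) is the set of invertible matrices of 'M[F]_n. *)

Section Invariants.
Local Open Scope classical_set_scope.
Variables (F : fieldType) (n : nat).
Implicit Types (G : set 'M[F]_n) (A : set (mixed_algebra F n)).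

Definition is_subgroup G : Prop :=
  [/\ forall U, G U -> U \in unitmx,
      G 1%:M,
      forall U W, G U -> G W -> G (U *m W) &
      forall U, G U -> G (invmx U)].

(* T^G *)
Definition tensor_invariants G : set (mixed_algebra F n) :=
  [set z | forall U, G U -> mact U z = z].

(* GL(n, F)^A *)
Definition GL_fixing A : set 'M[F]_n :=
  [set U | U \in unitmx /\ forall z, A z -> mact U z = z].

(* Value at U of a polynomial in the entries x_(i, j) of a matrix: the variable
   x_(i, j) is the one of index mxvec_index i j among n * n. *)
Definition eval_mx (p : mpoly.mpoly (n * n) F) (U : 'M[F]_n) : F :=
  mpoly.meval (fun k => mxvec U 0 k) p.

Definition vanishing_ideal G : set (mpoly.mpoly (n * n) F) :=
  [set p | forall U, G U -> eval_mx p U = 0].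

Definition zariski_closure G : set 'M[F]_n :=
  [set U | U \in unitmx /\ forall p, vanishing_ideal G p -> eval_mx p U = 0].
End Invariants.

Section Star.
Local Open Scope classical_set_scope.
Local Open Scope sesquilinear_scope.
Variables (C : numClosedFieldType) (n : nat).

Definition is_star_subgroup (G : set 'M[C]_n) : Prop :=
  is_subgroup G /\ G = [set U ^t* | U in G].
End Star.

(* Main.v *)
Require Import Defs.
From HB Require Import structures.
From mathcomp Require Import all_boot all_order all_algebra.
From mathcomp Require Import classical_sets reals complex.
From mathcomp Require Import boolp finmap spectral.
From mathcomp.multinomials Require Import monalg.
From mathcomp.multinomials Require mpoly.
Import (canonicals, coercions) mpoly.

Set Implicit Arguments.
Unset Strict Implicit.
Unset Printing Implicit Defensive.

Import Order.TTheory GRing.Theory Num.Theory.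
Local Open Scope ring_scope.
Local Open Scope sesquilinear_scope.

(** Why the theorem holds.

    All tensors in the sum of the V^k (x) V*^l with k, l <= d are encoded by one
    matrix Q indexed by the words of length at most d ([mx_tensor]).  If R is
    the representation of GL(n) on the direct sum of the V^k with k <= d
    ([tensor_rep]), then z^U corresponds to R(U) Q R(U)^-1, so the tensor of Q
    is fixed by U exactly when Q commutes with R(U) ([mact_fix_mx_tensor]).
    Every element of T arises in this way for some d ([mx_tensor_surj]).  So T^G
    is the union over d of the commutants of the R(G), and U fixes T^G exactly
    when R(U) lies in the bicommutant of R(G), for all d.

    The closure of G fixes T^G because the equation R(U) Q = Q R(U) is
    polynomial in the entries of U, with no inverse involved
    ([polynomial_fun_comm]).

    For the other inclusion, R(G) is closed under products and conjugate
    transposes and contains 1, so that its bicommutant is its linear span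
    ([star_bicommutant]).  A polynomial p of degree at most d is a linear form
    in the entries of R(U) ([eval_mx_tensor_rep]); if p vanishes on G, this form
    vanishes on the span of R(G), hence at R(U) for each U fixing T^G. *)

(** * The bicommutant of a set of matrices closed under adjoints *)

(** The linear span of a possibly infinite set of row vectors, as the row space
    of a matrix: one of minimal rank among those whose row space contains S. *)
Lemma rowspan_exists (F : fieldType) (m : nat) (S : set 'rV[F]_m) :
  exists A : 'M[F]_m, (forall v, S v -> (v <= A)%MS) /\
    forall p (B : 'M_(p, m)), (forall v, S v -> (v <= B)%MS) -> (A <= B)%MS.
Proof.
pose spanned r := `[< exists A : 'M[F]_m,
  \rank A = r /\ forall v, S v -> (v <= A)%MS >].
have exr : exists r, spanned r.
  exists (\rank (1%:M : 'M[F]_m)); apply/asboolP; exists 1%:M; split=> // v _.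
  exact: submx1.
case: (ex_minnP exr) => r /asboolP[A [rkA SA]] rmin; exists A; split=> // p B SB.
(* The intersection with B contains S, so minimality makes it all of A. *)
apply/capmx_idPl/eqmxP; rewrite -(geq_leqif (mxrank_leqif_eq (capmxSl A B))) rkA.
apply: rmin; apply/asboolP; exists (A :&: B)%MS; split=> // v Sv.
by rewrite sub_capmx SA // SB.
Qed.

Section Bicommutant.
Variable C : numClosedFieldType.

Lemma trmxC_mul m n p (A : 'M[C]_(m, n)) (B : 'M[C]_(n, p)) :
  (A *m B)^t* = B^t* *m A^t*.
Proof. by rewrite trmx_mul map_mxM. Qed.

(** If B and its adjoint both preserve the row space of A, then B also preserves
    the orthogonal complement, so that it commutes with the projection. *)
Lemma proj_ortho_comm m p (A : 'M[C]_(p, m)) (B : 'M[C]_m) :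
  (A *m B <= A)%MS -> (A *m B^t* <= A)%MS -> comm_mx B (proj_ortho A).
Proof.
move=> AB ABs; rewrite /comm_mx; set P := proj_ortho A.
have PA : (P <= A)%MS by rewrite -[P]mul1mx proj_ortho_sub.
have P'A : (1%:M - P) *m A^t* = 0.
  by have := proj_ortho_compl_sub A 1%:M; rewrite mul1mx => /orthomx1P.
rewrite -[B in LHS]mul1mx -[1%:M in LHS](subrK P) mulmxDl mulmxDl.
rewrite [_ *m B *m P]proj_ortho_0 ?add0r.
  by rewrite proj_ortho_id //; apply: submx_trans AB; exact: submxMr.
have [D ABD] := submxP ABs.
have -> : B = (B^t*)^t* by rewrite trmxCK.
by apply/orthomx1P; rewrite -mulmxA -trmxC_mul ABD trmxC_mul mulmxA P'A mul0mx.
Qed.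

Lemma lin_mulmxr_trC n (Y : 'M[C]_n) :
  (lin_mulmxr Y : 'M_(n * n))^t* = lin_mulmxr (Y^t*).
Proof.
have E (Z : 'M[C]_n) a b c d :
    (lin_mulmxr Z : 'M_(n * n)) (mxvec_index a b) (mxvec_index c d) =
    (a == c)%:R * Z b d.
  rewrite mxE /= vec_mx_delta mxvecE mxE (bigD1 b) //= !mxE !eqxx andbT big1.
    by rewrite addr0 eq_sym.
  by move=> e /negPf eb; rewrite mxE eb andbF mul0r.
apply/matrixP=> i j; case/mxvec_indexP: i => a b; case/mxvec_indexP: j => c d.
by rewrite 2!mxE !E !mxE rmorphM /= conjC_nat eq_sym.
Qed.

(** The finite-dimensional double commutant theorem, in dual form: a linear form
    c that vanishes on S vanishes at every X in the bicommutant of S.  View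
    matrices as n-tuples of rows, on which n x n matrices act by right
    multiplication.  The span A of S is stable under S, and the projection onto
    A commutes with this action; its n^2 blocks lie in the commutant of S, so X
    commutes with them and hence with the projection.  As 1 is in A, so is
    1 *m X = X. *)
Theorem star_bicommutant n (S : set 'M[C]_n) (X : 'M[C]_n) (c : 'cV[C]_(n * n)) :
  S 1%:M -> (forall Y Z, S Y -> S Z -> S (Y *m Z)) ->
  (forall Y, S Y -> S (Y^t*)) ->
  (forall Q, (forall Y, S Y -> comm_mx Q Y) -> comm_mx Q X) ->
  (forall Y, S Y -> mxvec Y *m c = 0) -> mxvec X *m c = 0.
Proof.
move=> S1 SM Sstar Xcomm Sc.
have [A [SA Amin]] := rowspan_exists [set mxvec Y | Y in S]%classic.
have {}SA Y : S Y -> (mxvec Y <= A)%MS by move=> SY; apply: SA; exists Y.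
have {}Amin p (B : 'M_(p, n * n)) : (forall Y, S Y -> (mxvec Y <= B)%MS) -> (A <= B)%MS.
  by move=> SB; apply: Amin => _ [Y SY <-]; exact: SB.
(* It is enough to place X in the span A of S, since c vanishes on A. *)
suff /submxP[D ->] : (mxvec X <= A)%MS.
  suff /sub_kermxP Ac : (A <= kermx c)%MS by rewrite -mulmxA Ac mulmx0.
  by apply: Amin => Y /Sc/sub_kermxP.
pose P := proj_ortho A.
pose phi (W : 'M[C]_n) := vec_mx (mxvec W *m P).
have AR Y : S Y -> (A *m lin_mulmxr Y <= A)%MS.
  move=> SY; rewrite submxE -mulmxA -sub_kermx; apply: Amin => Z SZ.
  by rewrite sub_kermx mulmxA mul_vec_lin -submxE SA //; exact: SM.
have PR Y : S Y -> comm_mx (lin_mulmxr Y) P.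
  move=> SY; apply: proj_ortho_comm; first exact: AR.
  by rewrite lin_mulmxr_trC; apply/AR/Sstar.
(* The (a, a') block of phi: put a row in position a, read off row a'. *)
pose Q a a' : 'M[C]_n :=
  lin1_mx (row a' \o vec_mx \o mulmxr P \o mxvec \o mulmx (delta_mx a (0 : 'I_1))).
have QE a a' w : w *m Q a a' = row a' (phi (delta_mx a 0 *m w)).
  by rewrite mul_rV_lin1.
have phiE W a' : row a' (phi W) = \sum_a row a W *m Q a a'.
  under eq_bigr do rewrite QE (rowE _ W) mulmxA mul_delta_mx.
  rewrite -linear_sum /= /phi -linear_sum -mulmx_suml -linear_sum /= -mulmx_suml.
  by rewrite -mx1_sum_delta mul1mx.
have phiS Y W : S Y -> phi (W *m Y) = phi W *m Y.
  move=> SY; have RE (Z : 'M_n) : mxvec (Z *m Y) = mxvec Z *m lin_mulmxr Y.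
    by rewrite mul_vec_lin.
  apply: (can_inj mxvecK); rewrite vec_mxK !RE vec_mxK.
  by rewrite -[LHS]mulmxA (PR _ SY) mulmxA.
have Qcomm a a' Y : S Y -> comm_mx (Q a a') Y.
  move=> SY; apply/row_matrixP=> i; rewrite !rowE !mulmxA !QE.
  by rewrite [in RHS]mulmxA phiS // row_mul.
have phiX : phi (1%:M *m X) = phi 1%:M *m X.
  apply/row_matrixP=> a'; rewrite row_mul !phiE mulmx_suml; apply: eq_bigr => a _.
  by rewrite row_mul -2!mulmxA (Xcomm (Q a a')) // => Y; exact: Qcomm.
have phi1 : phi 1%:M = 1%:M by rewrite /phi proj_ortho_id ?mxvecK //; exact: SA.
move: phiX; rewrite phi1 !mul1mx => <-.
by rewrite vec_mxK proj_ortho_sub.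
Qed.
End Bicommutant.

(** * The representation of GL(n) on tensors of degree at most d *)

Section Words.
Variables (F : fieldType) (n d : nat).
Implicit Types (U W : 'M[F]_n).

(** Words of length at most d index a basis of the direct sum of the V^k for
    k <= d.  The letters are a finite function rather than a list so that the
    expansion of a product of sums applies to sums over words. *)
Definition word := {k : 'I_d.+1 & {ffun 'I_k -> 'I_n}}.
HB.instance Definition _ := Finite.on word.
Implicit Types x y : word.

Definition mkword (k : 'I_d.+1) (f : {ffun 'I_k -> 'I_n}) : word :=
  Tagged (fun k : 'I_d.+1 => {ffun 'I_k -> 'I_n}) f.

Definition letters x : {fmonom 'I_n} := FMonom (codom (tagged x)).

Lemma letters_inj : injective letters.
Proof.
case=> [k f] [l g] [fg].
have kl : k = l.
  by apply: val_inj; have := congr1 size fg; rewrite !size_codom !card_ord.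
case: l / kl g fg => g fg; congr existT.
apply/ffunP=> i; move: fg; rewrite !codomE => /eq_in_map; apply.
by rewrite mem_enum.
Qed.

Lemma lettersP (w : {fmonom 'I_n}) : (size w <= d)%N -> exists x, letters x = w.
Proof.
rewrite -ltnS => wd; exists (@mkword (Ordinal wd) [ffun i => tnth (in_tuple w) i]).
apply: val_inj; rewrite /= codomE -[RHS](map_tnth_enum (in_tuple w)).
by apply: eq_map => i; rewrite ffunE.
Qed.

Lemma sum_word (M : nmodType) (k : 'I_d.+1) (E : word -> M) :
  (forall x, tag x != k -> E x = 0) ->
  \sum_x E x = \sum_(f : {ffun 'I_k -> 'I_n}) E (mkword f).
Proof.
move=> E0.
transitivity (\sum_(k : 'I_d.+1) \sum_(f : {ffun 'I_k -> 'I_n}) E (mkword f)).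
  by rewrite sig_big_dep /=; apply: eq_bigr => -[].
rewrite (bigD1 k) //= [X in _ + X]big1 ?addr0 // => l lk; rewrite big1 // => f _.
exact: E0.
Qed.

(** The matrix of U acting on the direct sum of the V^k: the Kronecker powers of
    U, in diagonal blocks. *)
Definition word_entry U x y : F :=
  (tag x == tag y)%:R * \prod_(i < tag x) U (tagged x i) (tagged_as x y i).

Lemma word_entryE U (k : 'I_d.+1) (f g : {ffun 'I_k -> 'I_n}) :
  word_entry U (mkword f) (mkword g) = \prod_(i < k) U (f i) (g i).
Proof. by rewrite /word_entry /= eqxx mul1r; under eq_bigr do rewrite tagged_asE. Qed.

Lemma word_entry_neq U x y : tag x != tag y -> word_entry U x y = 0.
Proof. by rewrite /word_entry => /negPf->; rewrite mul0r. Qed.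

(** Distributivity turns the product over letters of the entries of U *m W into
    a sum over words. *)
Lemma word_entryM U W x z :
  word_entry (U *m W) x z = \sum_y word_entry U x y * word_entry W y z.
Proof.
case: x z => [k f] [l h]; have [lk|kl] := eqVneq l k; last first.
  rewrite word_entry_neq 1?eq_sym // big1 // => -[m g] _.
  have [mk|km] := eqVneq m k; last by rewrite word_entry_neq ?mul0r // eq_sym.
  by rewrite (word_entry_neq W) ?mulr0 //= mk eq_sym.
case: k / lk f => f; rewrite (@sum_word _ l); last first.
  by move=> y yl; rewrite word_entry_neq ?mul0r // eq_sym.
rewrite word_entryE; under [RHS]eq_bigr do rewrite !word_entryE -big_split.
rewrite -(bigA_distr_bigA (fun i c => U (f i) c * W c (h i))).
by apply: eq_bigr => i _; rewrite mxE.
Qed.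

Lemma word_entry1 x y : word_entry 1%:M x y = (x == y)%:R.
Proof.
case: x y => [k f] [l g]; have [kl|kl] := eqVneq k l; last first.
  rewrite word_entry_neq //; case: eqP => // /(congr1 (@tag _ _)) /= E.
  by rewrite E eqxx in kl.
case: l / kl g => g; rewrite word_entryE.
rewrite -tag_eqE /tag_eq eqxx tagged_asE /=.
have [fg|fg] := eqVneq f g.
  by rewrite fg; apply: big1 => i _; rewrite mxE eqxx.
have /existsP[i fgi] : [exists i, f i != g i].
  by apply: contraNT fg => /existsPn fg0; apply/eqP/ffunP=> i; apply/eqP/negbNE.
by rewrite (bigD1 i) //= mxE (negPf fgi) mul0r.
Qed.

Lemma prod_malgU (I : Type) (r : seq I) (a : I -> F) (c : I -> 'I_n) :
  \prod_(i <- r) << a i *g fmu (c i) >> =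
  << \prod_(i <- r) a i *g FMonom (map c r) >> :> tensor_algebra F n.
Proof.
elim: r => [|i r IHr]; first by rewrite !big_nil /= -fmoneE.
rewrite !big_cons IHr malgUM; congr << _ *g _ >>.
by apply: val_inj; rewrite /= fmM fmU.
Qed.

(** The expansion of (U e_(i_1)) (x) ... (x) (U e_(i_k)) in the basis of words. *)
Lemma prod_tensor1 U x :
  \prod_(i <- letters x : seq 'I_n) tensor1 (U *m delta_mx i 0) =
  \sum_y << word_entry U y x *g letters y >>.
Proof.
(* The product is not commutative, so the letters must be kept in order. *)
have enumE k : enum 'I_k = index_enum 'I_k by rewrite [index_enum _]unlock enumT.
case: x => k f; rewrite /letters [LHS]/= codomE enumE big_map /=.
rewrite (@sum_word _ k) => [|y yk]; last first.
  by rewrite word_entry_neq // monalgU0.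
rewrite [LHS](eq_bigr (fun i => \sum_c << U c (f i) *g fmu c >>)); last first.
  by move=> i _; apply: eq_bigr => c _; rewrite -colE mxE.
rewrite bigA_distr_bigA; apply: eq_bigr => g _; rewrite word_entryE.
rewrite /letters /= codomE enumE.
exact: prod_malgU.
Qed.
End Words.

(** * Mixed tensors as matrices *)

Lemma sum_enum_val (M : nmodType) (I : finType) (E : I -> M) :
  \sum_x E x = \sum_(i < #|I|) E (enum_val i).
Proof. by rewrite (reindex _ (onW_bij _ (@enum_val_bij I))). Qed.

Section MalgFamily.
Variables (F : fieldType) (I : finType) (K : choiceType).
Implicit Types (c : I -> F) (h : I -> K).

Lemma mcoeff_family c h i : injective h ->
  (\sum_j << c j *g h j >>)@_(h i) = c i.
Proof.
move=> h_inj; rewrite raddf_sum /= (bigD1 i) //= mcoeffUU big1 ?addr0 // => j ji.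
by rewrite mcoeffU (inj_eq h_inj) (negPf ji).
Qed.

Lemma mcoeff_family_out c h k : (forall i, h i != k) ->
  (\sum_j << c j *g h j >>)@_k = 0.
Proof.
by move=> hk; rewrite raddf_sum /= big1 // => j _; rewrite mcoeffU (negPf (hk j)).
Qed.

Lemma malg_family_linear a c c' h :
  \sum_j << a * c j + c' j *g h j >> =
  a *: (\sum_j << c j *g h j >>) + \sum_j << c' j *g h j >>.
Proof.
rewrite scaler_sumr -big_split; apply: eq_bigr => j _ /=.
by apply/malgP=> k; rewrite mcoeffD mcoeffZ !mcoeffU mulrnDl mulrnAr.
Qed.

Lemma malg_family_delta h i :
  \sum_j << (j == i)%:R *g h j >> = << h i >> :> {malg F[K]}.
Proof.
rewrite (bigD1 i) //= eqxx big1 ?addr0 // => j /negPf->.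
by rewrite monalgU0.
Qed.
End MalgFamily.

Lemma eq_linear_delta (K : pzRingType) (p q : nat) (V : lmodType K)
    (f g : {linear 'M[K]_(p, q) -> V}) :
  (forall i j, f (delta_mx i j) = g (delta_mx i j)) -> f =1 g.
Proof.
move=> fg A; rewrite [A]matrix_sum_delta !linear_sum; apply: eq_bigr => i _.
by rewrite !linear_sum; apply: eq_bigr => j _; rewrite !linearZ fg.
Qed.

Section TensorMatrices.
Variables (F : fieldType) (n d : nat).
Implicit Types (U W : 'M[F]_n).
Local Notation N := #|{: word n d}|.

Definition tensor_rep U : 'M[F]_N :=
  \matrix_(i, j) word_entry U (enum_val i) (enum_val j).

Lemma tensor_repM U W : tensor_rep (U *m W) = tensor_rep U *m tensor_rep W.
Proof.
apply/matrixP=> i j; rewrite !mxE word_entryM sum_enum_val.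
by apply: eq_bigr => k _; rewrite !mxE.
Qed.

Lemma tensor_rep1 : tensor_rep 1%:M = 1%:M.
Proof.
by apply/matrixP=> i j; rewrite !mxE word_entry1 (inj_eq enum_val_inj).
Qed.

Lemma word_entry_tr U (x y : word n d) : word_entry U^T x y = word_entry U y x.
Proof.
case: x y => [k f] [l g]; have [kl|kl] := eqVneq k l; last first.
  by rewrite !word_entry_neq // eq_sym.
case: l / kl g => g; rewrite !word_entryE.
by apply: eq_bigr => i _; rewrite mxE.
Qed.

Lemma tensor_rep_tr U : tensor_rep U^T = (tensor_rep U)^T.
Proof. by apply/matrixP=> i j; rewrite !mxE word_entry_tr. Qed.

Lemma tensor_rep_map (s : {rmorphism F -> F}) U :
  tensor_rep (map_mx s U) = map_mx s (tensor_rep U).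
Proof.
apply/matrixP=> i j; rewrite !mxE /word_entry rmorphM rmorph_nat rmorph_prod.
by congr (_ * _); apply: eq_bigr => l _; rewrite mxE.
Qed.

Lemma tensor_repVmx U : U \in unitmx ->
  tensor_rep (invmx U) *m tensor_rep U = 1%:M.
Proof. by move=> Uu; rewrite -tensor_repM mulVmx // tensor_rep1. Qed.

Lemma tensor_repmxV U : U \in unitmx ->
  tensor_rep U *m tensor_rep (invmx U) = 1%:M.
Proof. by move=> Uu; rewrite -tensor_repM mulmxV // tensor_rep1. Qed.

Definition word_pair (p : 'I_N * 'I_N) : {fmonom 'I_n} * {fmonom 'I_n} :=
  (letters (enum_val p.1), letters (enum_val p.2)).

Lemma word_pair_inj : injective word_pair.
Proof.
move=> [i j] [i' j'] E.
have /letters_inj/enum_val_inj/= -> := congr1 fst E.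
by have /letters_inj/enum_val_inj/= -> := congr1 snd E.
Qed.

(** The first word of a pair indexes V^k and the second V*^l, so Q is read as
    a family of linear maps from V^l to V^k. *)
Definition mx_tensor (Q : 'M[F]_N) : mixed_algebra F n :=
  \sum_p << Q p.1 p.2 *g word_pair p >>.

Lemma mx_tensor_is_linear : linear mx_tensor.
Proof.
move=> a Q Q'; rewrite /mx_tensor -malg_family_linear.
by apply: eq_bigr => p _; rewrite !mxE.
Qed.

HB.instance Definition _ :=
  GRing.isLinear.Build F 'M[F]_N (mixed_algebra F n) *:%R mx_tensor
    mx_tensor_is_linear.

Lemma mcoeff_mx_tensor Q p : (mx_tensor Q)@_(word_pair p) = Q p.1 p.2.
Proof. exact: mcoeff_family word_pair_inj. Qed.

Lemma mx_tensor_inj : injective mx_tensor.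
Proof.
by move=> Q Q' E; apply/matrixP=> i j; rewrite -!(mcoeff_mx_tensor _ (i, j)) E.
Qed.

Lemma mx_tensor_delta i j : mx_tensor (delta_mx i j) = << word_pair (i, j) >>.
Proof.
rewrite -malg_family_delta; apply: eq_bigr => -[i' j'] _.
by rewrite mxE xpair_eqE.
Qed.

Lemma mact_letters U (x y : word n d) :
  mact U << (letters x, letters y) >> =
  tens (\sum_x' << word_entry U x' x *g letters x' >>)
       (\sum_y' << word_entry (invmx U^T) y' y *g letters y' >>).
Proof.
have prodl (r : seq 'I_n) (f : 'I_n -> 'cV[F]_n) :
    \prod_(i <- r) vec (f i) = tens (\prod_(i <- r) tensor1 (f i)) 1.
  by elim: r => [|i r IHr]; rewrite ?big_nil ?tens11 // !big_cons IHr tensM mulr1.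
have prodr (r : seq 'I_n) (f : 'I_n -> 'cV[F]_n) :
    \prod_(i <- r) covec (f i) = tens 1 (\prod_(i <- r) tensor1 (f i)).
  by elim: r => [|i r IHr]; rewrite ?big_nil ?tens11 // !big_cons IHr tensM mulr1.
by rewrite mact_word /word_act prodl prodr tensM mulr1 mul1r !prod_tensor1.
Qed.

(** U acts on the V factors by R(U) and on the V* factors by the transpose of
    R(U^-1), which becomes multiplication by R(U^-1) on the right. *)
Lemma mact_mx_tensor U Q :
  mact U (mx_tensor Q) = mx_tensor (tensor_rep U *m Q *m tensor_rep (invmx U)).
Proof.
pose f : {linear 'M[F]_N -> mixed_algebra F n} := mact U \o mx_tensor.
pose g : {linear 'M[F]_N -> mixed_algebra F n} :=
  mx_tensor \o mulmxr (tensor_rep (invmx U)) \o mulmx (tensor_rep U).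
suff fg i j : mact U (mx_tensor (delta_mx i j)) =
    mx_tensor (tensor_rep U *m delta_mx i j *m tensor_rep (invmx U)).
  exact: (@eq_linear_delta F _ _ _ f g fg Q).
rewrite mx_tensor_delta mact_letters !(@sum_enum_val _ (word n d)) tens_suml.
under eq_bigr do rewrite tens_sumr; rewrite pair_big.
apply: eq_bigr => -[i' j'] _; rewrite tensUU; congr << _ *g _ >>.
rewrite -(mul_delta_mx (0 : 'I_1)) mulmxA -colE -mulmxA -rowE !mxE big_ord1 !mxE.
by rewrite -trmx_inv word_entry_tr.
Qed.

Lemma mact_fix_mx_tensor U Q : U \in unitmx ->
  mact U (mx_tensor Q) = mx_tensor Q <-> comm_mx (tensor_rep U) Q.
Proof.
move=> Uu; rewrite mact_mx_tensor /comm_mx.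
have E := tensor_repmxV Uu; have E' := tensor_repVmx Uu.
move: (tensor_rep U) (tensor_rep (invmx U)) E E' => A B AB BA.
split=> [/mx_tensor_inj AQB|AQ].
  by rewrite -[in RHS]AQB -[in RHS]mulmxA BA mulmx1.
by congr mx_tensor; rewrite AQ -mulmxA AB mulmx1.
Qed.
End TensorMatrices.

(** The support of z is finite, so the lengths of its words are bounded. *)
Lemma mx_tensor_surj (F : fieldType) (n : nat) (z : mixed_algebra F n) :
  exists d, exists Q : 'M_#|{: word n d}|, z = mx_tensor Q.
Proof.
pose d := \max_(k <- msupp z) maxn (size k.1) (size k.2).
exists d.
pose Q : 'M_#|{: word n d}| := \matrix_(i, j)
  z@_(letters (enum_val i), letters (enum_val j)); exists Q.
have wd k : k \in msupp z -> exists p : 'I_#|{: word n d}| * 'I__, word_pair p = k.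
  move=> kz; have : (maxn (size k.1) (size k.2) <= d)%N by exact: leq_bigmax_seq.
  rewrite geq_max => /andP[/lettersP[x xk] /lettersP[y yk]].
  by exists (enum_rank x, enum_rank y); rewrite /word_pair !enum_rankK xk yk; case: (k).
apply/malgP => k; have [/wd[p <-]|kz] := boolP (k \in msupp z).
  by rewrite mcoeff_mx_tensor mxE.
rewrite (mcoeff_outdom kz).
have [[p pk]|nk] := pselect (exists p : 'I_#|{: word n d}| * 'I__, word_pair p = k).
  by rewrite -pk mcoeff_mx_tensor mxE -/(word_pair p) pk (mcoeff_outdom kz).
by apply/esym/mcoeff_family_out => p; apply/negP => /eqP pk; case: nk; exists p.
Qed.

(** * Polynomials in the entries of a matrix *)

Section Polynomials.
Variables (F : fieldType) (n : nat).
Implicit Types (U : 'M[F]_n) (f g : 'M[F]_n -> F).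

Definition polynomial_fun f := exists p, forall U, eval_mx p U = f U.

Lemma polynomial_fun_cst a : polynomial_fun (fun=> a).
Proof. by exists (mpoly.mpolyC _ a) => U; exact: mpoly.mevalC. Qed.

Lemma polynomial_fun_entry i j : polynomial_fun (fun U => U i j).
Proof. by eexists => U; rewrite -(mxvecE U i j); exact: mpoly.mevalXU. Qed.

Lemma polynomial_funD f g :
  polynomial_fun f -> polynomial_fun g -> polynomial_fun (fun U => f U + g U).
Proof.
by move=> [p pf] [q qg]; exists (p + q) => U; rewrite -pf -qg; exact: mpoly.mevalD.
Qed.

Lemma polynomial_funM f g :
  polynomial_fun f -> polynomial_fun g -> polynomial_fun (fun U => f U * g U).
Proof.
by move=> [p pf] [q qg]; exists (p * q) => U; rewrite -pf -qg; exact: mpoly.mevalM.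
Qed.

Lemma polynomial_fun_sum (I : Type) (r : seq I) (f : I -> 'M[F]_n -> F) :
  (forall i, polynomial_fun (f i)) ->
  polynomial_fun (fun U => \sum_(i <- r) f i U).
Proof.
move=> fP; elim: r => [|i r [p pr]].
  by have [p p0] := polynomial_fun_cst 0; exists p => U; rewrite big_nil p0.
have [q qE] := polynomial_funD (fP i) (ex_intro _ p pr).
by exists q => U; rewrite qE big_cons.
Qed.

Lemma polynomial_fun_prod (I : Type) (r : seq I) (f : I -> 'M[F]_n -> F) :
  (forall i, polynomial_fun (f i)) ->
  polynomial_fun (fun U => \prod_(i <- r) f i U).
Proof.
move=> fP; elim: r => [|i r [p pr]].
  by have [p p1] := polynomial_fun_cst 1; exists p => U; rewrite big_nil p1.
have [q qE] := polynomial_funM (fP i) (ex_intro _ p pr).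
by exists q => U; rewrite qE big_cons.
Qed.

(** Unlike the equation z^U = z, the commutation relation does not involve U^-1:
    this is what makes it polynomial in U. *)
Lemma polynomial_fun_comm d (Q : 'M[F]_#|{: word n d}|) i j :
  polynomial_fun (fun U => (tensor_rep d U *m Q - Q *m tensor_rep d U) i j).
Proof.
have repP k l : polynomial_fun (fun U => tensor_rep d U k l).
  have [p pE] := polynomial_funM
    (polynomial_fun_cst (tag (enum_val k) == tag (enum_val l))%:R)
    (polynomial_fun_prod (index_enum _) (fun t => polynomial_fun_entry
       (tagged (enum_val k) t) (tagged_as (enum_val k) (enum_val l) t))).
  by exists p => U; rewrite pE mxE.
have [p pE] := polynomial_funD
  (polynomial_fun_sum (index_enum _) (fun k =>
     polynomial_funM (repP i k) (polynomial_fun_cst (Q k j))))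
  (polynomial_funM (polynomial_fun_cst (-1))
    (polynomial_fun_sum (index_enum _) (fun k =>
       polynomial_funM (polynomial_fun_cst (Q i k)) (repP k j)))).
by exists p => U; rewrite pE !mxE mulN1r.
Qed.

(** The row indices of the factors form one word and the column indices
    another. *)
Lemma prod_entries_word_entry d (s : seq ('I_n * 'I_n)) : (size s <= d)%N ->
  exists x y : word n d, forall U, \prod_(t <- s) U t.1 t.2 = word_entry U x y.
Proof.
rewrite -ltnS => sd; pose t := tnth (in_tuple s).
exists (@mkword n d (Ordinal sd) [ffun i => (t i).1]).
exists (@mkword n d (Ordinal sd) [ffun i => (t i).2]) => U.
by rewrite word_entryE big_tnth; apply: eq_bigr => i _; rewrite !ffunE.
Qed.

Lemma monomial_entries (m : mpoly.multinom (n * n)) :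
  exists2 s : seq ('I_n * 'I_n), size s = mpoly.mdeg m &
    forall U, \prod_i mxvec U 0 i ^+ m i = \prod_(t <- s) U t.1 t.2.
Proof.
have [ix _ ixK] := @curry_mxvec_bij n n.
pose s := flatten [seq nseq (m i) (ix i) | i <- index_enum 'I_(n * n)].
exists s => [|U].
  rewrite size_flatten /shape -map_comp sumnE big_map mpoly.mdegE.
  by apply: eq_bigr => i _; rewrite /= size_nseq.
rewrite big_flatten big_map; apply: eq_bigr => i _.
rewrite big_nseq iter_mulr_1; congr (_ ^+ _).
by rewrite -[RHS]mxvecE -[i in LHS](ixK i isT); case: (ix i).
Qed.

(** A polynomial is in general not homogeneous, which is why the
    representation must gather all the degrees up to a bound. *)
Lemma eval_mx_tensor_rep (p : mpoly.mpoly (n * n) F) :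
  exists d, exists c : 'cV[F]_(#|{: word n d}| * #|{: word n d}|),
    forall U, mxvec (tensor_rep d U) *m c = (eval_mx p U)%:M.
Proof.
pose d := mpoly.msize p; exists d.
have lin (r : seq (mpoly.multinom (n * n))) (a : mpoly.multinom (n * n) -> F) :
    (forall m, m \in r -> (mpoly.mdeg m <= d)%N) -> exists c, forall U,
    mxvec (tensor_rep d U) *m c = (\sum_(m <- r) a m * \prod_i mxvec U 0 i ^+ m i)%:M.
  elim: r => [|m r IHr] rd.
    by exists 0 => U; rewrite mulmx0 big_nil raddf0.
  have [|c cE] := IHr; first by move=> m' rm'; apply: rd; rewrite inE rm' orbT.
  have [s sm sE] := monomial_entries m.
  have [|x [y xyE]] := @prod_entries_word_entry d s.
    by rewrite sm rd // mem_head.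
  exists (a m *: delta_mx (mxvec_index (enum_rank x) (enum_rank y)) 0 + c) => U.
  rewrite mulmxDr cE big_cons raddfD -scalemxAr -colE sE xyE; congr (_ + _).
  by apply/rowP=> k; rewrite ord1 !mxE mxvecE mxE !enum_rankK eqxx.
have [|c cE] := lin (mpoly.msupp p) (fun m => mpoly.mcoeff m p).
  by move=> m /mpoly.msize_mdeg_lt/ltnW.
by exists c => U; rewrite cE /eval_mx mpoly.mevalE.
Qed.
End Polynomials.

(** * Invariant tensors and the Zariski closure *)

Section Main.
Variables (C : numClosedFieldType) (n : nat).
Implicit Types (G : set 'M[C]_n) (U : 'M[C]_n).

Lemma tensor_rep_trC d U : tensor_rep d (U^t*) = (tensor_rep d U)^t*.
Proof. by rewrite tensor_rep_map tensor_rep_tr. Qed.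

Lemma mx_tensor_invariant d G (Q : 'M_#|{: word n d}|) : is_subgroup G ->
  tensor_invariants G (mx_tensor Q) <->
  forall W, G W -> comm_mx (tensor_rep d W) Q.
Proof.
case=> Gu _ _ _; split=> GQ W GW; apply/(mact_fix_mx_tensor _ (Gu W GW));
  exact: GQ.
Qed.

Lemma zariski_closure_sub_fixing G U : is_subgroup G ->
  zariski_closure G U -> GL_fixing (tensor_invariants G) U.
Proof.
move=> sG [Uu GU]; split=> // z; have [d [Q ->]] := mx_tensor_surj z.
move=> /(mx_tensor_invariant _ sG) GQ; apply/mact_fix_mx_tensor => //.
apply/subr0_eq/matrixP=> i j; have [p pE] := polynomial_fun_comm Q i j.
rewrite -pE mxE; by apply: GU => W GW; rewrite pE GQ // subrr mxE.
Qed.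

Lemma fixing_sub_zariski_closure G U : is_star_subgroup G ->
  GL_fixing (tensor_invariants G) U -> zariski_closure G U.
Proof.
move=> [sG Gstar] [Uu GU]; split=> // p pG; have [_ G1 GM _] := sG.
have [d [c cE]] := eval_mx_tensor_rep p.
suff : mxvec (tensor_rep d U) *m c = 0.
  by rewrite cE => /matrixP/(_ 0 0); rewrite !mxE eqxx mulr1n.
apply: (@star_bicommutant _ _ [set tensor_rep d W | W in G]%classic).
- by exists 1%:M => //; exact: tensor_rep1.
- move=> _ _ [W GW <-] [W' GW' <-]; exists (W *m W'); first exact: GM.
  exact: tensor_repM.
- move=> _ [W GW <-]; exists (W^t*); last exact: tensor_rep_trC.
  by rewrite Gstar; exists W.
- move=> Q GQ; apply/comm_mx_sym/mact_fix_mx_tensor => //; apply: GU.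
  apply/mx_tensor_invariant => // W GW; apply/comm_mx_sym/GQ.
  by exists W.
- by move=> _ [W GW <-]; rewrite cE pG // raddf0.
Qed.
End Main.

Theorem theorem2 (R : realType) (n : nat) (hn : (0 < n)%N)
    (G : set 'M[R[i]]_n) (hG : is_star_subgroup G) :
  GL_fixing (tensor_invariants G) = zariski_closure G.
Proof.
apply/seteqP; split=> U; first exact: fixing_sub_zariski_closure.
by apply: zariski_closure_sub_fixing; case: hG.
Qed.
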